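(* Let $A,B$ be commutative rings with unity, $f:A\to B$ a ring homomorphism, and $J$ an ideal of $B$ which is finitely generated as an $A$-module (via $f$). Then $A\bowtie^f J$ is universally catenary if and only if $A$ is universally catenary.
   Context: For a ring homomorphism $f:A\to B$ of commutative rings and an ideal $J$ of $B$, the amalgamation is the subring $A\bowtie^f J:=\{(a,f(a)+j)\mid a\in A,\ j\in J\}$ of $A\times B$. A locally finite dimensional commutative ring $R$ (every localization at a prime has finite Krull dimension) is catenary if for all primes $\mathfrak p\subseteq\mathfrak q$ every saturated chain of primes joining $\mathfrak p$ and $\mathfrak q$ has length equal to the height of $\mathfrak q/\mathfrak p$. $R$ is universally catenary if all the polynomial rings $R[X_1,\ldots,X_n]$ are catenary. *)

(* Defs.v *)
From HB Require Import structures.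
From mathcomp Require Import all_boot all_algebra ring_quotient generic_quotient.
From mathcomp Require Import boolp mpoly ring.

Set Implicit Arguments.
Unset Strict Implicit.
Unset Printing Implicit Defensive.

Import GRing.Theory.
Local Open Scope ring_scope.
Local Open Scope quotient_scope.

(* Ideals are boolean predicates, as in ring_quotient; under the classical
   axioms of boolp these are exactly the subsets of the ring. *)

(* The library's [idealr] only covers proper ideals; here J = B is allowed. *)
HB.mixin Record isMulAbsorbing (R : comPzRingType) (S : R -> bool) := {
  ideal_absorb : forall a, {in S, forall u, a * u \in S}
}.

#[short(type="ideal")]
HB.structure Definition Ideal (R : comPzRingType) :=
  {S of GRing.ZmodClosed R S & isMulAbsorbing R S}.

Section Amalgamation.
Variables (A B : comPzRingType) (f : {rmorphism A -> B}) (J : ideal B).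

(* (a, b) is of the form (a, f a + j) with j in J *)
Definition amalg_pred : pred (A * B) := fun x => x.2 - f x.1 \in J.

Lemma amalg_predE (x : A * B) : (x \in amalg_pred) = (x.2 - f x.1 \in J).
Proof. by []. Qed.

Lemma amalg_predP (x : A * B) :
  reflect (exists2 j, j \in J & x = (x.1, f x.1 + j)) (x \in amalg_pred).
Proof.
rewrite amalg_predE; case: x => a b /=; apply: (iffP idP) => [Jx|[j Jj [->]]].
  by exists (b - f a); rewrite // addrC subrK.
by rewrite addrAC subrr add0r.
Qed.

Lemma amalg_subring : subring_closed amalg_pred.
Proof.
split=> [|x y|x y]; rewrite !amalg_predE /=.
- by rewrite rmorph1 subrr rpred0.
- move=> Jx Jy; rewrite rmorphB opprB.
  have -> : x.2 - y.2 + (f y.1 - f x.1) = (x.2 - f x.1) - (y.2 - f y.1).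
    by rewrite opprB addrACA [RHS]addrACA [- y.2 + _]addrC [- f x.1 - _]addrC.
  exact: rpredB.
- move=> Jx Jy; rewrite rmorphM.
  have -> : x.2 * y.2 - f x.1 * f y.1
            = y.2 * (x.2 - f x.1) + f x.1 * (y.2 - f y.1).
    by rewrite !mulrBr addrA (mulrC y.2) (mulrC y.2) subrK.
  by apply: rpredD; apply: ideal_absorb.
Qed.

HB.instance Definition _ := GRing.isSubringClosed.Build (A * B)%type amalg_pred
  amalg_subring.

Record amalg := Amalg { amalg_val :> A * B; _ : amalg_val \in amalg_pred }.

HB.instance Definition _ := [isSub for amalg_val].
HB.instance Definition _ := [Choice of amalg by <:].
HB.instance Definition _ :=
  GRing.SubChoice_isSubComPzRing.Build (A * B)%type amalg_pred amalg amalg_subring.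

Definition fg_module_via : Prop :=
  exists (n : nat) (g : 'I_n -> B),
    (forall i, g i \in J) /\
    (forall x, x \in J -> exists c : 'I_n -> A, x = \sum_i f (c i) * g i).

End Amalgamation.

Module Localization.
Section Localization.
Variables (R : comNzRingType) (p : prime_idealr R).

Record frac := Frac { fracval :> R * R; _ : fracval.2 \notin p }.

#[export]
HB.instance Definition _ := [isSub for fracval].
#[export]
HB.instance Definition _ := [Choice of frac by <:].

Implicit Types x y z : frac.

Lemma denP x : x.2 \notin p. Proof. by case: x. Qed.

Lemma one_notin : 1 \notin p. Proof. by rewrite idealr1. Qed.

Lemma mul_notin (s t : R) : s \notin p -> t \notin p -> s * t \notin p.
Proof. by move=> ps pt; rewrite prime_idealrM negb_or ps pt. Qed.

Definition equivl x y : bool :=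
  `[< exists2 u : R, u \notin p & u * (x.1 * y.2 - y.1 * x.2) = 0 >].

Lemma equivl_refl : reflexive equivl.
Proof.
by move=> x; apply/asboolP; exists 1; rewrite ?one_notin // subrr mulr0.
Qed.

Lemma equivl_sym : ssrbool.symmetric equivl.
Proof.
have H x y : equivl x y -> equivl y x.
  move=> /asboolP[u pu e]; apply/asboolP; exists u => //.
  by rewrite -opprB mulrN e oppr0.
by move=> x y; apply/idP/idP; apply: H.
Qed.

Lemma equivl_trans : transitive equivl.
Proof.
move=> y x z /asboolP[u pu e] /asboolP[v pv h]; apply/asboolP.
exists (u * v * y.2); first by rewrite !mul_notin ?denP.
have -> : u * v * y.2 * (x.1 * z.2 - z.1 * x.2) =
  v * z.2 * (u * (x.1 * y.2 - y.1 * x.2)) +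
  u * x.2 * (v * (y.1 * z.2 - z.1 * y.2)) by ring.
by rewrite e h !mulr0 addr0.
Qed.

Canonical equivl_equiv := EquivRel equivl equivl_refl equivl_sym equivl_trans.

Definition type := {eq_quot equivl}.
#[export]
HB.instance Definition _ : EqQuotient _ equivl type := EqQuotient.on type.
#[export]
HB.instance Definition _ := Choice.on type.

Definition emb (a : R) : frac := @Frac (a, 1) one_notin.
Definition addl x y : frac :=
  @Frac (x.1 * y.2 + y.1 * x.2, x.2 * y.2) (mul_notin (denP x) (denP y)).
Definition oppl x : frac := @Frac (- x.1, x.2) (denP x).
Definition mull x y : frac :=
  @Frac (x.1 * y.1, x.2 * y.2) (mul_notin (denP x) (denP y)).

Lemma equivl_repr x : equivl x (repr (\pi_type x)).
Proof. by apply/eqmodP; rewrite reprK. Qed.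

Definition add := lift_op2 type addl.
Lemma pi_add : {morph \pi : x y / addl x y >-> add x y}.
Proof.
move=> x y; unlock add; apply/eqmodP => /=.
have /asboolP[u pu e] := equivl_repr x; have /asboolP[v pv h] := equivl_repr y.
move: (repr (\pi_type x)) (repr (\pi_type y)) e h => x' y' e h.
apply/asboolP; exists (u * v); rewrite ?mul_notin //=.
have -> : u * v * ((x.1 * y.2 + y.1 * x.2) * (x'.2 * y'.2)
                 - (x'.1 * y'.2 + y'.1 * x'.2) * (x.2 * y.2)) =
  v * y.2 * y'.2 * (u * (x.1 * x'.2 - x'.1 * x.2)) +
  u * x.2 * x'.2 * (v * (y.1 * y'.2 - y'.1 * y.2)) by ring.
by rewrite e h !mulr0 addr0.
Qed.
Canonical pi_add_morph := PiMorph2 pi_add.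

Definition opp := lift_op1 type oppl.
Lemma pi_opp : {morph \pi : x / oppl x >-> opp x}.
Proof.
move=> x; unlock opp; apply/eqmodP => /=.
have /asboolP[u pu e] := equivl_repr x.
apply/asboolP; exists u => //=.
by rewrite !mulNr -opprD mulrN e oppr0.
Qed.
Canonical pi_opp_morph := PiMorph1 pi_opp.

Definition mul := lift_op2 type mull.
Lemma pi_mul : {morph \pi : x y / mull x y >-> mul x y}.
Proof.
move=> x y; unlock mul; apply/eqmodP => /=.
have /asboolP[u pu e] := equivl_repr x; have /asboolP[v pv h] := equivl_repr y.
move: (repr (\pi_type x)) (repr (\pi_type y)) e h => x' y' e h.
apply/asboolP; exists (u * v); rewrite ?mul_notin //=.
have -> : u * v * (x.1 * y.1 * (x'.2 * y'.2) - x'.1 * y'.1 * (x.2 * y.2)) =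
  v * y.1 * y'.2 * (u * (x.1 * x'.2 - x'.1 * x.2)) +
  u * x'.1 * x.2 * (v * (y.1 * y'.2 - y'.1 * y.2)) by ring.
by rewrite e h !mulr0 addr0.
Qed.
Canonical pi_mul_morph := PiMorph2 pi_mul.

Definition of_base := lift_embed type emb.
Canonical of_base_morph := PiEmbed of_base.

Lemma eq_frac x y : x.1 * y.2 = y.1 * x.2 -> \pi_type x = \pi_type y.
Proof.
move=> e; apply/eqmodP/asboolP; exists 1; first exact: one_notin.
by rewrite e subrr mulr0.
Qed.

Lemma addA : associative add.
Proof.
elim/quotW=> x; elim/quotW=> y; elim/quotW=> z; rewrite !piE.
by apply: eq_frac => /=; ring.
Qed.

Lemma addC : commutative add.
Proof.
by elim/quotW=> x; elim/quotW=> y; rewrite !piE; apply: eq_frac => /=; ring.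
Qed.

Lemma add0l : left_id (of_base 0) add.
Proof. by elim/quotW=> x; rewrite !piE; apply: eq_frac => /=; ring. Qed.

Lemma addNl : left_inverse (of_base 0) opp add.
Proof. by elim/quotW=> x; rewrite !piE; apply: eq_frac => /=; ring. Qed.

#[export]
HB.instance Definition _ := GRing.isZmodule.Build type addA addC add0l addNl.

Lemma mulA : associative mul.
Proof.
elim/quotW=> x; elim/quotW=> y; elim/quotW=> z; rewrite !piE.
by apply: eq_frac => /=; ring.
Qed.

Lemma mulC : commutative mul.
Proof.
by elim/quotW=> x; elim/quotW=> y; rewrite !piE; apply: eq_frac => /=; ring.
Qed.

Lemma mul1l : left_id (of_base 1) mul.
Proof. by elim/quotW=> x; rewrite !piE; apply: eq_frac => /=; ring. Qed.

Lemma mulDl : left_distributive mul add.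
Proof.
elim/quotW=> x; elim/quotW=> y; elim/quotW=> z; rewrite !piE.
by apply: eq_frac => /=; ring.
Qed.

Lemma nonzero1 : of_base 1 != of_base 0.
Proof.
rewrite piE; apply/asboolP => -[u pu] /=.
by rewrite mulr1 mul0r subr0 mulr1 => u0; rewrite u0 rpred0 in pu.
Qed.

#[export]
HB.instance Definition _ :=
  GRing.Zmodule_isComNzRing.Build type mulA mulC mul1l mulDl nonzero1.

End Localization.

Module Exports.
HB.reexport.
Canonical equivl_equiv.
Canonical pi_add_morph.
Canonical pi_opp_morph.
Canonical pi_mul_morph.
Canonical of_base_morph.
End Exports.
End Localization.
Export Localization.Exports.

Notation localization := Localization.type.

Section Chains.
Variable R : comNzRingType.
Implicit Types (p q r : prime_idealr R) (c : nat -> prime_idealr R) (n : nat).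

Definition prime_lt p q : Prop := {subset p <= q} /\ ~ {subset q <= p}.

(* The chain c 0 < c 1 < ... < c n, of length n; the values of c beyond n are
   irrelevant. *)
Definition prime_chain c n : Prop :=
  forall i, (i < n)%N -> prime_lt (c i) (c i.+1).

Definition saturated_chain p q c n : Prop :=
  [/\ c 0%N =i p, c n =i q, prime_chain c n &
      forall i, (i < n)%N -> ~ exists r, prime_lt (c i) r /\ prime_lt r (c i.+1)].

Definition finite_krull_dim : Prop :=
  exists n, forall c m, prime_chain c m -> (m <= n)%N.

Definition has_height q n : Prop :=
  (exists2 c, prime_chain c n & c n =i q) /\
  (forall c m, prime_chain c m -> c m =i q -> (m <= n)%N).

End Chains.

Section QuotientPrime.
Variables (R : comNzRingType) (p q : prime_idealr R).
Hypothesis le_pq : {subset p <= q}.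

Definition quot_pred : pred {ideal_quot p} :=
  fun y => `[< exists2 x, x \in q & y = \pi_{ideal_quot p} x >].

Lemma quot_predE x : (\pi_{ideal_quot p} x \in quot_pred) = (x \in q).
Proof.
apply/asboolP/idP => [[z qz /eqP]|qx]; last by exists x.
rewrite -Quotient.idealrBE => /le_pq qxz.
by rewrite -(subrK z x) rpredD.
Qed.

Lemma quot_pred_ideal : idealr_closed quot_pred.
Proof.
split=> [||a y z].
- by rewrite -(rmorph0 (\pi_{ideal_quot p})) quot_predE rpred0.
- by rewrite -(rmorph1 (\pi_{ideal_quot p})) quot_predE idealr1.
- elim/quotW: a => a; elim/quotW: y => y; elim/quotW: z => z.
  rewrite -rmorphM -rmorphD !quot_predE => qy qz.
  by rewrite rpredD ?idealMr.
Qed.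

Lemma quot_pred_prime : prime_idealr_closed quot_pred.
Proof.
elim/quotW=> y; elim/quotW=> z.
by rewrite -rmorphM !quot_predE prime_idealrM.
Qed.

(* the prime ideal q/p of R/p *)
Definition quot_prime : prime_idealr {ideal_quot p} :=
  HB.pack quot_pred (isIdealr.Build {ideal_quot p} quot_pred quot_pred_ideal)
    (isPrimeIdealrClosed.Build {ideal_quot p} quot_pred quot_pred_prime).

End QuotientPrime.

Definition locally_finite_dim (R : comNzRingType) : Prop :=
  forall p : prime_idealr R, finite_krull_dim (localization p).

Definition catenary (R : comNzRingType) : Prop :=
  locally_finite_dim R /\
  forall (p q : prime_idealr R) (le_pq : {subset p <= q})
         (c : nat -> prime_idealr R) (n : nat),
    saturated_chain p q c n -> has_height (quot_prime le_pq) n.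

Definition nonzero_ring (R : comPzRingType) (nz : 1 != 0 :> R) :
  comNzRingType := HB.pack (R : Type) R (GRing.PzSemiRing_isNonZero.Build R nz).

(* {mpoly R[n]} requires 1 != 0 in R.  Polynomial rings over the zero ring are
   zero, hence have no primes and are vacuously catenary. *)
Definition universally_catenary (R : comPzRingType) : Prop :=
  forall (nz : 1 != 0 :> R) (n : nat), catenary {mpoly (nonzero_ring nz)[n]}.

(* Main.v *)
Require Import Defs.
From HB Require Import structures.
From mathcomp Require Import all_boot all_algebra.
From mathcomp Require Import ring_quotient generic_quotient boolp mpoly ring.

(* The ring A ⋈ J is a finite A-algebra through a |-> (a, f a), generated as a
   module by 1 and the (0, g i), and conversely A is the quotient of A ⋈ J by
   0 × J.  So it suffices that a finite algebra R over a universally catenary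
   ring A is universally catenary: R[X_1..X_n] is a quotient of
   A[X_1..X_n, Y_1..Y_m], and catenarity passes to quotients because the primes
   of a quotient are the primes of the ring above the kernel: chains of primes,
   saturated or not, are the same between two such primes. *)

Set Implicit Arguments.
Unset Strict Implicit.
Unset Printing Implicit Defensive.

Import GRing.Theory.
Import (coercions) Localization.
Local Open Scope ring_scope.
Local Open Scope quotient_scope.

(** * Contraction of primes and of chains of primes *)

Section Comap.
Variables (R S : comNzRingType) (phi : {rmorphism R -> S}).

Section ComapPrime.
Variable q : prime_idealr S.

Definition comap_pred : pred R := fun x => phi x \in q.

Lemma comap_predE x : (x \in comap_pred) = (phi x \in q).
Proof. by []. Qed.

Lemma comap_pred_ideal : idealr_closed comap_pred.
Proof.
split=> [||a x y]; rewrite !comap_predE.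
- by rewrite rmorph0 rpred0.
- by rewrite rmorph1 idealr1.
- by move=> qx qy; rewrite rmorphD rmorphM rpredD ?idealMr.
Qed.

Lemma comap_pred_prime : prime_idealr_closed comap_pred.
Proof. by move=> x y; rewrite !comap_predE rmorphM prime_idealrM. Qed.

Definition comap : prime_idealr R :=
  HB.pack comap_pred (isIdealr.Build R comap_pred comap_pred_ideal)
    (isPrimeIdealrClosed.Build R comap_pred comap_pred_prime).

Lemma comapE x : (x \in comap) = (phi x \in q).
Proof. by []. Qed.

End ComapPrime.

(** The property common to surjections and localizations: together with the monotonicity of
    contraction it makes the spectrum of [S] an ordered subset of that of [R], so that chains can be
    transported both ways. *)
Definition comap_reflects_le : Prop :=
  forall q q', {subset comap q <= comap q'} -> {subset q <= q'}.

Hypothesis phi_refl : comap_reflects_le.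

Lemma comap_lt q q' : prime_lt (comap q) (comap q') <-> prime_lt q q'.
Proof.
have le_comap (r r' : prime_idealr S) :
    {subset comap r <= comap r'} <-> {subset r <= r'}.
  by split=> [/phi_refl//|le_rr' x]; rewrite !comapE; apply: le_rr'.
by rewrite /prime_lt !le_comap.
Qed.

Lemma comap_chain c n :
  prime_chain c n -> prime_chain (fun i => comap (c i)) n.
Proof. by move=> cP i /cP /comap_lt. Qed.

Lemma lift_chain (c : nat -> prime_idealr R) n :
  prime_chain c n ->
  (forall i, (i <= n)%N -> exists q, comap q =i c i) ->
  exists2 c', prime_chain c' n & forall i, (i <= n)%N -> comap (c' i) =i c i.
Proof.
(* [q0] is only the default value of the lifted chain at indices beyond [n]. *)
move=> cP cl; have [q0 _] := cl 0%N isT.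
have /choice[c' c'P] i : exists q, (i <= n)%N -> comap q =i c i.
  case: (boolP (i <= n)%N) => [/cl[q qE]|_]; last by exists q0.
  by exists q.
exists c' => // i lt_in; apply/comap_lt; have [le nle] := cP i lt_in.
have [E E'] := (c'P i (ltnW lt_in), c'P i.+1 lt_in).
split=> [x|h]; first by rewrite E E'; apply: le.
by apply: nle => x; rewrite -E -E'; apply: h.
Qed.

End Comap.

Lemma chain_le (R : comNzRingType) (c : nat -> prime_idealr R) n i j :
  prime_chain c n -> (i <= j <= n)%N -> {subset c i <= c j}.
Proof.
move=> cP; elim: j => [|j IHj] /andP[le_ij le_jn].
  by move: le_ij; rewrite leqn0 => /eqP->.
move: le_ij; rewrite leq_eqVlt => /predU1P[->//|le_ij] x cx.
by apply: (cP j le_jn).1; apply: IHj; rewrite // -ltnS le_ij ltnW.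
Qed.

(** * Primes of a quotient ring *)

Section Surjection.
Variables (R S : comNzRingType) (phi : {rmorphism R -> S}).
Hypothesis phi_surj : forall y, exists x, y = phi x.

Lemma surj_comap_reflects_le : comap_reflects_le phi.
Proof.
by move=> q q' le_qq' y; have [x ->] := phi_surj y; apply: (le_qq' x).
Qed.

Section Lift.
Variables (q : prime_idealr R).
Hypothesis ker_q : forall x, phi x = 0 -> x \in q.

Definition image_pred : pred S := fun y => `[< exists2 x, x \in q & y = phi x >].

(** Two preimages of one element differ by an element of the kernel, which [ker_q] places in [q]. *)
Lemma image_predE x : (phi x \in image_pred) = (x \in q).
Proof.
apply/asboolP/idP => [[z qz e]|qx]; last by exists x.
by rewrite -(subrK z x) rpredD // ker_q // rmorphB e subrr.
Qed.

Lemma image_pred_ideal : idealr_closed image_pred.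
Proof.
split=> [||a x y].
- by rewrite -(rmorph0 phi) image_predE rpred0.
- by rewrite -(rmorph1 phi) image_predE idealr1.
- have [{}a ->] := phi_surj a; have [{}x ->] := phi_surj x.
  have [{}y ->] := phi_surj y.
  by rewrite -rmorphM -rmorphD !image_predE => qx qy; rewrite rpredD ?idealMr.
Qed.

Lemma image_pred_prime : prime_idealr_closed image_pred.
Proof.
move=> x y; have [{}x ->] := phi_surj x; have [{}y ->] := phi_surj y.
by rewrite -rmorphM !image_predE prime_idealrM.
Qed.

Definition image_prime : prime_idealr S :=
  HB.pack image_pred (isIdealr.Build S image_pred image_pred_ideal)
    (isPrimeIdealrClosed.Build S image_pred image_pred_prime).

Lemma comap_image_prime : comap phi image_prime =i q.
Proof. by move=> x; rewrite comapE image_predE. Qed.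

End Lift.

(** Every contracted prime contains the kernel, hence so does any prime above it. *)
Lemma surj_lift_prime (p : prime_idealr S) (q : prime_idealr R) :
  {subset comap phi p <= q} -> exists q', comap phi q' =i q.
Proof.
move=> le_pq; have ker_q x : phi x = 0 -> x \in q.
  by move=> x0; apply: le_pq; rewrite comapE x0 rpred0.
by exists (image_prime ker_q); apply: comap_image_prime.
Qed.

Lemma comap_eq_surj (q q' : prime_idealr S) :
  comap phi q =i comap phi q' -> q =i q'.
Proof. by move=> e y; have [x ->] := phi_surj y; apply: (e x). Qed.

End Surjection.

(** * Primes of a localization *)

Section LocalizationPrimes.
Variables (R : comNzRingType) (p : prime_idealr R).
Local Notation Rp := (localization p).

Definition loc_map (a : R) : Rp := \pi_Rp (Localization.emb p a).

Lemma loc_map_is_zmod_morphism : zmod_morphism loc_map.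
Proof.
by move=> x y; rewrite /loc_map !piE; apply: Localization.eq_frac => /=; ring.
Qed.

Lemma loc_map_is_monoid_morphism : monoid_morphism loc_map.
Proof.
split=> [|x y]; rewrite /loc_map !piE //.
by apply: Localization.eq_frac => /=; ring.
Qed.

HB.instance Definition _ :=
  GRing.isZmodMorphism.Build R Rp loc_map loc_map_is_zmod_morphism.
HB.instance Definition _ :=
  GRing.isMonoidMorphism.Build R Rp loc_map loc_map_is_monoid_morphism.

(** A fraction is the image of its numerator times a unit, so a prime of [Rp] is determined by the
    numerators in it. *)
Lemma loc_comap_reflects_le : comap_reflects_le loc_map.
Proof.
move=> q q' le_qq'; elim/quotW=> x qx.
pose v : Localization.frac p := @Localization.Frac _ p (1, x.2) (Localization.denP x).
have num : loc_map x.1 = loc_map x.2 * \pi_Rp x.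
  by rewrite /loc_map !piE; apply: Localization.eq_frac => /=; ring.
have -> : \pi_Rp x = \pi_Rp v * loc_map x.1.
  by rewrite /loc_map !piE; apply: Localization.eq_frac => /=; ring.
by apply/idealMr/(le_qq' x.1); rewrite comapE /= num idealMr.
Qed.

Section Lift.
Variables (q : prime_idealr R).
Hypothesis le_qp : {subset q <= p}.

Definition loc_pred : pred Rp :=
  fun y => `[< exists2 x : Localization.frac p, x.1 \in q & y = \pi_Rp x >].

(** Equality of fractions can be cleared of [u] and of the denominators: these lie outside [p],
    hence outside the prime [q], and can be cancelled from a product in [q]. *)
Lemma loc_predE x : (\pi_Rp x \in loc_pred) = (x.1 \in q).
Proof.
apply/asboolP/idP => [[z qz /eqmodP /asboolP[u pu e]]|qx]; last by exists x.
have notin s : s \notin p -> (s \in q) = false.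
  by move=> ps; apply/negbTE/(contra _ ps)/le_qp.
have : u * (x.1 * z.2 - z.1 * x.2) \in q by rewrite e rpred0.
rewrite prime_idealrM notin //= => qxz.
have : x.1 * z.2 \in q.
  by rewrite -(subrK (z.1 * x.2) (x.1 * z.2)) rpredD // mulrC idealMr.
by rewrite prime_idealrM (notin z.2) ?Localization.denP // orbF.
Qed.

Lemma loc_pred_ideal : idealr_closed loc_pred.
Proof.
split=> [||a x y].
- by rewrite -(rmorph0 loc_map) loc_predE rpred0.
- by rewrite -(rmorph1 loc_map) loc_predE idealr1.
- elim/quotW: a => a; elim/quotW: x => x; elim/quotW: y => y.
  rewrite !piE !loc_predE /= => qx qy.
  by apply: rpredD; rewrite mulrC; [rewrite idealMr ?idealMr | rewrite idealMr].
Qed.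

Lemma loc_pred_prime : prime_idealr_closed loc_pred.
Proof.
by elim/quotW=> x; elim/quotW=> y; rewrite !piE !loc_predE /= prime_idealrM.
Qed.

Definition loc_prime : prime_idealr Rp :=
  HB.pack loc_pred (isIdealr.Build Rp loc_pred loc_pred_ideal)
    (isPrimeIdealrClosed.Build Rp loc_pred loc_pred_prime).

Lemma comap_loc_prime : comap loc_map loc_prime =i q.
Proof. by move=> x; rewrite comapE loc_predE. Qed.

End Lift.

(** An element outside [p] becomes a unit of [Rp], and no prime contains a unit. *)
Lemma loc_comap_le (q : prime_idealr Rp) : {subset comap loc_map q <= p}.
Proof.
move=> x; rewrite comapE; apply: contraTT => px.
pose v : Localization.frac p := @Localization.Frac _ p (1, x) px.
apply/negP => /(idealMr (\pi_Rp v)).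
have -> : \pi_Rp v * loc_map x = 1.
  rewrite -(rmorph1 loc_map) /loc_map !piE.
  by apply: Localization.eq_frac => /=; ring.
by rewrite idealr1.
Qed.

(** Eliminates the localization, so that local dimensions of different rings can be compared by
    contracting chains. Testing the top of the chain against [p] suffices, as the other terms lie
    below it. *)
Lemma finite_krull_dim_locP :
  finite_krull_dim Rp <->
  exists n, forall (c : nat -> prime_idealr R) m,
    prime_chain c m -> {subset c m <= p} -> (m <= n)%N.
Proof.
split=> -[n nP]; exists n => c m cP.
  move=> le_cp.
  have [|c' c'P _] := lift_chain loc_comap_reflects_le cP; last exact: (nP c').
  move=> i le_im; have le_cip : {subset c i <= p}.
    by move=> x cx; apply/le_cp/(chain_le cP _ cx); rewrite le_im /=.
  by exists (loc_prime le_cip); apply: comap_loc_prime.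
apply: (nP _ _ (comap_chain loc_comap_reflects_le cP)).
exact: loc_comap_le.
Qed.

End LocalizationPrimes.

(** * Heights in a quotient by a prime *)

Section Height.
Variables (R : comNzRingType) (p q : prime_idealr R).
Hypothesis le_pq : {subset p <= q}.
Local Notation Q := {ideal_quot p}.

Lemma pi_surj (y : Q) : exists x, y = \pi_Q x.
Proof. by elim/quotW: y => x; exists x. Qed.

(** Eliminates the quotient: the height of q/p is read off from the chains of [R] that run from a
    prime above [p] up to [q]. *)
Lemma has_height_quotP n :
  has_height (quot_prime le_pq) n <->
  (exists c, [/\ prime_chain c n, {subset p <= c 0%N} & c n =i q]) /\
  (forall c m, prime_chain c m -> {subset p <= c 0%N} -> c m =i q ->
     (m <= n)%N).
Proof.
pose phi : {rmorphism R -> Q} := \pi_Q.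
have refl : comap_reflects_le phi by apply: surj_comap_reflects_le pi_surj.
have comap_quot : comap phi (quot_prime le_pq) =i q.
  by move=> x; rewrite comapE quot_predE.
have le_comap (r : prime_idealr Q) : {subset p <= comap phi r}.
  move=> x px; rewrite comapE; suff -> : phi x = 0 by rewrite rpred0.
  by rewrite -(rmorph0 phi); apply/eqP; rewrite -Quotient.idealrBE subr0.
have lift c m : prime_chain c m -> {subset p <= c 0%N} -> c m =i q ->
    exists2 c', prime_chain c' m & c' m =i quot_prime le_pq.
  move=> cP le_pc cE.
  have [i le_im|c' c'P c'E] := lift_chain refl cP.
    have ker_c x : phi x = 0 -> x \in c i.
      move=> x0; apply: (chain_le cP (i := 0)); rewrite ?le_im //; apply: le_pc.
      by rewrite -[x]subr0 Quotient.idealrBE; apply/eqP; rewrite [LHS]x0 rmorph0.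
    by exists (image_prime pi_surj ker_c); apply: comap_image_prime.
  exists c' => //; apply: (comap_eq_surj (phi := phi) pi_surj) => x.
  by rewrite c'E // cE comap_quot.
split=> -[].
  move=> [c cP cE] max; split.
    exists (fun i => comap phi (c i)); split=> [||x].
    - exact: comap_chain.
    - exact: le_comap.
    - by rewrite comapE cE -comap_quot.
  by move=> c' m c'P le_pc /(lift _ _ c'P le_pc)[c'' c''P /(max _ _ c''P)].
move=> [c [cP le_pc cE]] max; split; first exact: lift cE.
move=> c' m c'P c'E; apply: (max (fun i => comap phi (c' i))).
- exact: comap_chain.
- exact: le_comap.
- by move=> x; rewrite comapE c'E -comap_quot.
Qed.

End Height.

(** * Catenarity of quotients and of finite algebras *)

Lemma catenary_surj (R S : comNzRingType) (phi : {rmorphism R -> S}) :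
  (forall y, exists x, y = phi x) -> catenary R -> catenary S.
Proof.
move=> surj [dimR catR]; have refl := surj_comap_reflects_le surj.
split=> [p|p q le_pq c n [c0 cn cP satc]].
  apply/finite_krull_dim_locP.
  have /finite_krull_dim_locP[n nP] := dimR (comap phi p).
  exists n => c m cP le_cp; apply: (nP _ _ (comap_chain refl cP)) => x.
  exact: le_cp.
have le_comap (r r' : prime_idealr S) :
    {subset r <= r'} -> {subset comap phi r <= comap phi r'}.
  by move=> le_rr' x; apply: le_rr'.
have sat : saturated_chain (comap phi p) (comap phi q)
             (fun i => comap phi (c i)) n.
  split=> [x|x||i lt_in [r [cr rc]]]; rewrite ?comapE ?c0 ?cn //.
    exact: comap_chain.
  (* A prime [r] refining the contracted chain lies above the contraction of [c i], so it is itself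
     a contraction and would refine [c] in [S]. *)
  have [r' r'E] := surj_lift_prime surj cr.1.
  apply: (satc i lt_in); exists r'; split; apply/(comap_lt refl).
    split=> [x|h]; first by rewrite r'E; apply: cr.1.
    by apply: cr.2 => x; rewrite -r'E; apply: h.
  split=> [x|h]; first by rewrite r'E; apply: rc.1.
  by apply: rc.2 => x; rewrite -r'E; apply: h.
have /has_height_quotP[_ max] := catR _ _ (le_comap _ _ le_pq) _ _ sat.
(* The chain [c] itself attains length [n]; any competing chain contracts to one of [R], where [max]
   bounds it. *)
apply/has_height_quotP; split.
  by exists c; split=> // x; rewrite c0.
move=> c' m c'P le_pc c'E; apply: (max _ _ (comap_chain refl c'P)).
  exact: le_comap.
by move=> x; rewrite !comapE c'E.
Qed.

(** The first [n] variables go to the variables and the last [m] to the constants [g k]. The image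
    is closed under sums and products, so it is enough to reach constants and variables. *)
Lemma mpoly_finite_surj (A R : comNzRingType) (iota : {rmorphism A -> R})
    m (g : 'I_m -> R) n :
  (forall r, exists c : 'I_m -> A, r = \sum_i iota (c i) * g i) ->
  exists phi : {rmorphism {mpoly A[n + m]} -> {mpoly R[n]}},
    forall y, exists x, y = phi x.
Proof.
move=> gen.
pose h (i : 'I_(n + m)) : {mpoly R[n]} :=
  match split i with inl j => 'X_j | inr k => (g k)%:MP end.
pose phi : {rmorphism {mpoly A[n + m]} -> {mpoly R[n]}} :=
  mmap (@mpolyC n R \o iota) h.
exists phi; pose im y := exists x, y = phi x.
have imD y z : im y -> im z -> im (y + z).
  by move=> [a ->] [b ->]; exists (a + b); rewrite rmorphD.
have imM y z : im y -> im z -> im (y * z).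
  by move=> [a ->] [b ->]; exists (a * b); rewrite rmorphM.
have im0 : im 0 by exists 0; rewrite rmorph0.
have im1 : im 1 by exists 1; rewrite rmorph1.
have imh i : im (h i) by exists 'X_i; rewrite /phi /= mmapX mmap1U.
have imX j : im 'X_j.
  by have := imh (lshift m j); rewrite /h (unsplitK (inl j)).
have img k : im (g k)%:MP.
  by have := imh (rshift n k); rewrite /h (unsplitK (inr k)).
have imA a : im (iota a)%:MP by exists a%:MP; rewrite /phi /= mmapC.
(* Module generation enters here: a constant is a sum of products of the constants reached by [imA]
   and [img]. *)
have imC r : im r%:MP.
  have [c ->] := gen r; rewrite rmorph_sum /=.
  apply: (big_ind im im0 imD) => i _.
  by rewrite rmorphM; apply: imM; [apply: imA | apply: img].
move=> y; rewrite -/(im y) [y]mpolyE; apply: (big_ind im im0 imD) => u _.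
rewrite -mul_mpolyC; apply: (imM) => //; rewrite mpolyXE_id.
apply: (big_ind im im1 imM) => i _; elim: (u i) => [|k IHk]; first by rewrite expr0.
by rewrite exprS; apply: imM.
Qed.

(** Quotients are included, with 1 as the single generator, so this serves both directions of the
    theorem. *)
Lemma universally_catenary_finite (A R : comPzRingType)
    (iota : {rmorphism A -> R}) m (g : 'I_m -> R) :
  (forall r, exists c : 'I_m -> A, r = \sum_i iota (c i) * g i) ->
  universally_catenary A -> universally_catenary R.
Proof.
move=> gen catA nzR n.
(* Polynomial rings over [A] can be formed only once [A] is known to be nonzero. *)
have nzA : 1 != 0 :> A.
  by apply: contra nzR => /eqP e; rewrite -(rmorph1 iota) e rmorph0.
have [phi] := @mpoly_finite_surj (nonzero_ring nzA) (nonzero_ring nzR) iota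
  m g n gen.
by move/catenary_surj; apply; apply: catA.
Qed.

(** * The amalgamation as a finite algebra over [A] *)

Section AmalgMorphisms.
Variables (A B : comPzRingType) (f : {rmorphism A -> B}) (J : ideal B).
Local Notation D := (amalg f J).

Definition amalg_fst (x : D) : A := (val x).1.

Lemma amalg_fst_is_zmod_morphism : zmod_morphism amalg_fst.
Proof. by move=> x y; rewrite /amalg_fst rmorphB. Qed.

Lemma amalg_fst_is_monoid_morphism : monoid_morphism amalg_fst.
Proof. by split=> [|x y]; rewrite /amalg_fst ?rmorph1 ?rmorphM. Qed.

HB.instance Definition _ :=
  GRing.isZmodMorphism.Build D A amalg_fst amalg_fst_is_zmod_morphism.
HB.instance Definition _ :=
  GRing.isMonoidMorphism.Build D A amalg_fst amalg_fst_is_monoid_morphism.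

Lemma amalg_in_subproof a : (a, f a) \in amalg_pred f J.
Proof. by rewrite amalg_predE subrr rpred0. Qed.

Definition amalg_in (a : A) : D := Amalg (amalg_in_subproof a).

Lemma amalg_in_is_zmod_morphism : zmod_morphism amalg_in.
Proof. by move=> x y; apply: val_inj; rewrite rmorphB /= rmorphB. Qed.

Lemma amalg_in_is_monoid_morphism : monoid_morphism amalg_in.
Proof.
split=> [|x y]; apply: val_inj; first by rewrite /= !rmorph1.
by rewrite rmorphM /= rmorphM.
Qed.

HB.instance Definition _ :=
  GRing.isZmodMorphism.Build A D amalg_in amalg_in_is_zmod_morphism.
HB.instance Definition _ :=
  GRing.isMonoidMorphism.Build A D amalg_in amalg_in_is_monoid_morphism.

(** Split (a, b) as (a, f a) + (0, b - f a) and expand b - f a, which lies in [J], in the generators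
    of [J]. *)
Lemma amalg_finite : fg_module_via f J ->
  exists m (g : 'I_m -> D),
    forall x, exists c : 'I_m -> A, x = \sum_i amalg_in (c i) * g i.
Proof.
move=> [n [g [gJ gen]]].
have gP i : (0, g i) \in amalg_pred f J.
  by rewrite amalg_predE /= rmorph0 subr0.
(* Index 0 carries the unit, index [lift ord0 j] the element (0, g j). *)
pose g' (i : 'I_n.+1) : D := oapp (fun j => Amalg (gP j)) 1 (unlift ord0 i).
exists n.+1, g' => x.
have /gen[c cE] : (val x).2 - f (val x).1 \in J by apply: (valP x).
exists (fun i => oapp c (val x).1 (unlift ord0 i)).
rewrite big_ord_recl /g' unlift_none /= mulr1.
under eq_bigr do rewrite liftK /=.
have valE j : val (amalg_in (c j) * Amalg (gP j)) = (0, f (c j) * g j).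
  by rewrite rmorphM /= -[LHS]/(c j * 0, _) mulr0.
apply: val_inj; rewrite [RHS]rmorphD [X in _ + X]rmorph_sum.
rewrite (eq_bigr _ (fun j _ => valE j)).
rewrite (surjective_pairing (\sum_i _)) !raddf_sum /= big1 // -cE /=.
rewrite -[RHS]/(_ + 0, _ + _) addr0 addrC subrK; exact: surjective_pairing.
Qed.

End AmalgMorphisms.

Theorem corollary4p4 (A B : comPzRingType) (f : {rmorphism A -> B})
  (J : ideal B) (Jfg : fg_module_via f J) :
  universally_catenary (amalg f J) <-> universally_catenary A.
Proof.
split; last first.
  by have [m [g gen]] := amalg_finite Jfg; apply: universally_catenary_finite gen.
(* The first projection has the section [amalg_in], so 1 generates [A] over the amalgamation. *)
apply: (@universally_catenary_finite _ _ (@amalg_fst A B f J) 1 (fun=> 1)) => a.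
by exists (fun=> amalg_in f J a); rewrite big_ord1 mulr1.
Qed.
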